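(* Let $(w_t)_{t\in\mathbb N}$ be a sequence of positive real numbers such that $C_1(w)<\infty$. For each $t\in\mathbb N$, let $\mathcal T_t$ be a set of at most $2^t$ measure-preserving transformations of a probability space $(X,\mu)$. Then for every $f\in L^1(X,\mu)$, $$\lim_{t\to\infty} w_t2^{-t}\sum_{T\in\mathcal T_t} f(Tx)=0$$ for almost every $x$.
   Context: For a sequence $(w_t)_{t\in\mathbb N}$ of positive reals, with $\mathbb N=\{1,2,\ldots\}$, $$C_1(w)=\sup_{y>0}\sum_{t}[y<w_t<2^ty]\,w_t,$$ where $[P]$ is $1$ if the condition $P$ holds and $0$ otherwise. *)

(* Defs.v *)
From HB Require Import structures.
From mathcomp Require Import all_boot all_order all_algebra.
From mathcomp Require Import all_classical all_reals all_analysis.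
Set Implicit Arguments.
Unset Strict Implicit.
Unset Printing Implicit Defensive.
Import Order.TTheory GRing.Theory Num.Theory.
Import numFieldNormedType.Exports.
Local Open Scope classical_set_scope.
Local Open Scope ring_scope.

(* Sequences are indexed by t >= 1; the value w 0 is never used. *)
Definition C1 (R : realType) (w : nat -> R) : \bar R :=
  ereal_sup [set (\sum_(1 <= t <oo | (y < w t < 2 ^+ t * y)%R) (w t)%:E)%E
            | y in [set y : R | 0 < y]].

(* Invertibility is not required. *)
Definition measure_preserving (d : measure_display) (X : measurableType d)
    (R : realType) (mu : probability X R) (S : X -> X) : Prop :=
  measurable_fun [set: X] S /\
  forall A : set X, measurable A -> mu (S @^-1` A) = mu A.

(* Main.v *)
Require Import Defs.
From HB Require Import structures.
From mathcomp Require Import all_boot all_order all_algebra.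
From mathcomp Require Import all_classical all_reals all_analysis.
From mathcomp Require Import measurable_realfun lra.
Import Order.TTheory GRing.Theory Num.Theory.
Import numFieldNormedType.Exports.
Local Open Scope classical_set_scope.
Local Open Scope ring_scope.

(** For every a > 0 the averages are, from some time on, below 2a almost
    everywhere, because up to an error a they are dominated by the terms of a
    series of nonnegative functions with finite integral.

    Fix a > 0 and let the clip at time t of a number u >= 0 be
    - 0 when w_t u <= a;
    - w_t u when a < w_t u < 2^t a;
    - 2^t a when 2^t a <= w_t u.
    The middle range says a/u < w_t < 2^t (a/u), which is the window in the
    definition of C_1(w) at y = a/u; so the middle terms, summed over t, give at
    most C_1(w) u.  Since all weights are at most C_1(w), the last range forces
    2^t a <= C_1(w) u, and a sum of powers of two not exceeding M is at most 2M.
    Hence the clips of u sum to at most 3 C_1(w) u ([clip_sum_le]).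

    Replace w_t |f| at time t by the clip of |f|.  Each T in the t-th set
    preserves integrals and there are at most 2^t of them, so averaging with the
    weight 2^-t does not increase the integral ([integral_average_le]).  The
    averages of the clips therefore form a series of integral at most
    3 C_1(w) ||f||_1, and almost everywhere its terms tend to 0.

    As soon as the average of the clips is below a, no value of |f(Tx)| lies in
    the last range, because one such value would contribute 2^-t 2^t a = a by
    itself.  Every term then satisfies w_t |f(Tx)| <= a + clip, and averaging
    gives w_t 2^-t sum |f(Tx)| < 2a ([average_lt_of_clip_average_lt]).  Letting a
    run through the numbers 1/(n+1) gives the limit. *)

(** * Consequences of the finiteness of C_1 *)

Lemma C1_partial_sum_le {R : realType} {w : nat -> R} {y : R} (n : nat) :
  (forall t, (1 <= t)%N -> 0 < w t) -> (C1 w < +oo)%E -> 0 < y ->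
  \sum_(t < n | y < w t.+1 < 2 ^+ t.+1 * y) w t.+1 <= fine (C1 w).
Proof.
move=> w_gt0 C1_fin y_gt0.
have le_C1 : ((\sum_(t < n | y < w t.+1 < 2 ^+ t.+1 * y) w t.+1)%:E <= C1 w)%E.
  apply: (@le_trans _ _
    (\sum_(1 <= t <oo | (y < w t < 2 ^+ t * y)%R) (w t)%:E)%E); last first.
    by apply: ereal_sup_ubound; exists y.
  apply: le_trans (nneseries_lim_ge n.+1 _); last first.
    by move=> t t_ge1 _; rewrite lee_fin ltW ?w_gt0.
  by rewrite big_add1 big_mkord sumEFin.
have C1_ge0 : (0 <= C1 w)%E.
  by apply: le_trans le_C1; rewrite lee_fin sumr_ge0// => t _; rewrite ltW ?w_gt0.
by rewrite -lee_fin fineK // ge0_fin_numE.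
Qed.

(** The weight w_t lies in its own window ]y, 2^t y[ for y slightly below it. *)
Lemma weight_le_C1 {R : realType} {w : nat -> R} (t : nat) :
  (forall t, (1 <= t)%N -> 0 < w t) -> (C1 w < +oo)%E ->
  w t.+1 <= fine (C1 w).
Proof.
move=> w_gt0 C1_fin; have wt_gt0 := w_gt0 t.+1 isT.
(* Any factor strictly between 1/2 and 1 works: since t.+1 >= 1, the window
   ends at or above twice its start. *)
have y_gt0 : 0 < 3 / 4 * w t.+1 by rewrite mulr_gt0 // divr_gt0.
apply: le_trans (C1_partial_sum_le t.+1 w_gt0 C1_fin y_gt0).
rewrite big_mkcond big_ord_recr /= ifT ?lerDr.
  apply: sumr_ge0 => i _; case: ifP => // _; exact/ltW/w_gt0.
have : 1 <= 2 ^+ t :> R by rewrite exprn_ege1 // ler1n.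
rewrite exprS => pow_ge1; apply/andP; split; nra.
Qed.

Lemma dyadic_sum_le {R : realType} {a M : R} (n : nat) : 0 <= a -> 0 <= M ->
  \sum_(t < n) (if 2 ^+ t.+1 * a <= M then 2 ^+ t.+1 * a else 0) <= 2 * M.
Proof.
move=> a_ge0 M_ge0.
(* The second bound makes the induction go through: when the term added next is
   at most M, the sum so far is at most that term, so the new sum is at most 2M. *)
suff: \sum_(t < n) (if 2 ^+ t.+1 * a <= M then 2 ^+ t.+1 * a else 0) <=
      Num.min (2 * M) (2 ^+ n.+1 * a) by rewrite le_min => /andP[].
elim: n => [|n]; first by rewrite big_ord0 le_min !mulr_ge0 ?exprn_ge0.
have pow_ge0 : 0 <= 2 ^+ n.+1 * a by rewrite mulr_ge0 ?exprn_ge0.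
rewrite big_ord_recr /= !le_min [2 ^+ n.+2]exprS => /andP[sum_leM sum_lea].
by case: ifPn; [move=> ? | rewrite -ltNge => ?]; apply/andP; split; lra.
Qed.

(** * Clipped values *)

Definition clip {R : realType} (w : nat -> R) (a : R) (t : nat) (u : R) : R :=
  if a < w t * u then Num.min (w t * u) (2 ^+ t * a) else 0.

Lemma clip_ge0 (R : realType) (w : nat -> R) (a : R) (t : nat) (u : R) :
  0 <= a -> 0 <= clip w a t u.
Proof.
move=> a_ge0; rewrite /clip; case: ifP => // a_lt.
by rewrite le_min (le_trans a_ge0 (ltW a_lt)) mulr_ge0 ?exprn_ge0.
Qed.

(** The middle range is paid by the supremum defining C_1, taken at y = a/u, and
    the range where the value is cut at 2^t a by a geometric series. *)
Lemma clip_sum_le (R : realType) (w : nat -> R) (a u : R) (n : nat) :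
  (forall t, (1 <= t)%N -> 0 < w t) -> (C1 w < +oo)%E -> 0 < a -> 0 <= u ->
  \sum_(t < n) clip w a t.+1 u <= 3 * fine (C1 w) * u.
Proof.
move=> w_gt0 C1_fin a_gt0; rewrite le_eqVlt => /predU1P[<-|u_gt0].
  by rewrite mulr0 big1 // => t _; rewrite /clip mulr0 ltNge ltW.
have C_ge0 := le_trans (ltW (w_gt0 1%N isT)) (weight_le_C1 0 w_gt0 C1_fin).
have y_gt0 : 0 < a / u by rewrite divr_gt0.
have mid := C1_partial_sum_le n w_gt0 C1_fin y_gt0.
have large := dyadic_sum_le n (ltW a_gt0) (mulr_ge0 C_ge0 (ltW u_gt0)).
have {}mid := ler_wpM2r (ltW u_gt0) mid.
apply: (@le_trans _ _ ((\sum_(t < n | a / u < w t.+1 < 2 ^+ t.+1 * (a / u)) w t.+1) * u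
   + \sum_(t < n) (if 2 ^+ t.+1 * a <= fine (C1 w) * u then 2 ^+ t.+1 * a else 0)));
  last by lra.
rewrite [X in X * u]big_mkcond mulr_suml -big_split /=; apply: ler_sum => t _.
have wC : w t.+1 * u <= fine (C1 w) * u by rewrite ler_pM2r // weight_le_C1.
have pow_gt0 : 0 < 2 ^+ t.+1 * a by rewrite mulr_gt0 ?exprn_gt0.
rewrite mulrA ltr_pdivrMr // ltr_pdivlMr // /clip.
case: ltP => /= [a_lt|_]; last by rewrite mul0r add0r; case: ifP => // _; exact/ltW.
case: ltP => [w_lt|w_ge].
  by rewrite lerDl; case: ifP => // _; exact/ltW.
by rewrite mul0r add0r ifT // (le_trans w_ge).
Qed.

Lemma measurable_clip (R : realType) (w : nat -> R) (a : R) (t : nat) :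
  measurable_fun [set: R] (clip w a t).
Proof.
have mw : measurable_fun [set: R] (fun u => w t * u) by exact: measurable_funM.
apply: measurable_fun_ifT => //; first exact: measurable_fun_ltr.
exact: measurable_minr.
Qed.

(** A term that is cut would alone bring the average of the clips up to a, so the
    hypothesis excludes cutting, and clipping discards at most a from each term. *)
Lemma average_lt_of_clip_average_lt (R : realType) (w : nat -> R) (a : R)
    (t m : nat) (u : 'I_m -> R) : 0 < a -> (m <= 2 ^ t)%N ->
  2 ^- t * \sum_(i < m) clip w a t (u i) < a ->
  w t * 2 ^- t * \sum_(i < m) u i < 2 * a.
Proof.
move=> a_gt0 m_le avg_lt; have pow_gt0 : 0 < 2 ^+ t :> R by rewrite exprn_gt0.
have clip_lt i : clip w a t (u i) < 2 ^+ t * a.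
  apply: le_lt_trans (_ : _ <= \sum_(j < m) clip w a t (u j)) _.
    rewrite (bigD1 i) //= lerDl; apply: sumr_ge0 => j _; exact/clip_ge0/ltW.
  by rewrite -ltr_pdivrMl // mulrC -mulrC.
have w_le i : w t * u i <= a + clip w a t (u i).
  move: (clip_lt i); rewrite /clip; case: (ltP a) => [a_lt|]; last by rewrite addr0.
  by rewrite gt_min ltxx orbF => /ltW/min_idPl ->; rewrite lerDr ltW.
rewrite mulrAC mulrC mulr_sumr.
have /ler_wpM2l h : \sum_(i < m) w t * u i <=
    2 ^+ t * a + \sum_(i < m) clip w a t (u i).
  apply: (@le_trans _ _ (\sum_(i < m) (a + clip w a t (u i)))).
    exact: ler_sum.
  rewrite big_split /= lerD2r sumr_const card_ord -[a *+ m]mulr_natl.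
  by rewrite ler_pM2r // -natrX ler_nat.
have := h (2 ^- t); rewrite invr_ge0 (ltW pow_gt0) => /(_ isT).
rewrite mulrDr mulKf ?gt_eqF //; lra.
Qed.

(** * Almost everywhere convergence *)

(** A series of nonnegative functions whose integrals have a finite sum converges
    almost everywhere, so its terms tend to 0; they are bounded by the tails. *)
Lemma ae_near_lt_of_integrable_series (d : measure_display) (X : measurableType d)
    (R : realType) (mu : measure X R) (g : nat -> X -> R) (a : R) :
  (forall n, measurable_fun [set: X] (g n)) -> (forall n x, 0 <= g n x) ->
  (\sum_(0 <= n <oo) \int[mu]_x (g n x)%:E < +oo)%E -> 0 < a ->
  {ae mu, forall x, \forall n \near \oo, g n x < a}.
Proof.
move=> mg g_ge0 g_fin a_gt0.
have mEg n : measurable_fun [set: X] (fun x => (g n x)%:E) by exact/measurable_EFinP.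
have Eg_ge0 n x : (0 <= (g n x)%:E)%E by rewrite lee_fin.
have int_sum : mu.-integrable [set: X] (fun x => (\sum_(0 <= n <oo) (g n x)%:E)%E).
  apply/integrableP; split.
    by apply: ge0_emeasurable_sum => // n x _ _.
  under eq_integral => x _ do rewrite gee0_abs ?nneseries_ge0 //.
  by rewrite integral_nneseries.
apply: filterS (integrable_ae measurableT int_sum) => x /(_ I) sum_fin.
have /nneseries_tail_cvg : (\sum_(0 <= n <oo) (g n x)%:E < +oo)%E.
  by rewrite ltey_eq sum_fin.
move=> /(_ (fun n _ => Eg_ge0 n x)) tail_cvg.
have : nbhs (0 : \bar R)%E [set z : \bar R | (z < a%:E)%E].
  by apply: open_nbhs_nbhs; split; [exact: open_ereal_lt_ereal | rewrite /= lte_fin].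
case/tail_cvg => N _ tail_lt; exists N => // n /tail_lt /=; rewrite -lte_fin.
apply: le_lt_trans.
have := @nneseries_lim_ge R (fun k => (g k x)%:E) xpredT n n.+1 (fun k _ _ => Eg_ge0 k x).
by rewrite big_nat1.
Qed.

Lemma integral_measure_preserving (d : measure_display) (X : measurableType d)
    (R : realType) (mu : probability X R) (S : X -> X) (g : X -> R) :
  measure_preserving mu S -> measurable_fun [set: X] g -> (forall x, 0 <= g x) ->
  (\int[mu]_x (g (S x))%:E = \int[mu]_x (g x)%:E)%E.
Proof.
move=> [mS Smu] mg g_ge0.
have := @ge0_integral_pushforward _ _ _ _ R S mS mu [set: X] (EFin \o g) measurableT.
rewrite preimage_setT => <- //; first last.
- by move=> x _; rewrite /= lee_fin.
- exact/measurable_EFinP.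
by apply: eq_measure_integral => A mA _; exact: Smu.
Qed.

(** Normalising by N instead of by the number m of transformations is harmless
    because only an upper bound is needed; N = 0 gives m = 0. *)
Lemma integral_average_le (d : measure_display) (X : measurableType d)
    (R : realType) (mu : probability X R) (N m : nat) (S : nat -> X -> X)
    (g : X -> R) : (m <= N)%N -> (forall i, measure_preserving mu (S i)) ->
  measurable_fun [set: X] g -> (forall x, 0 <= g x) ->
  (\int[mu]_x (N%:R^-1 * \sum_(i < m) g (S i x))%:E <= \int[mu]_x (g x)%:E)%E.
Proof.
move=> m_le S_mp mg g_ge0.
have mgS i : measurable_fun [set: X] (fun x => g (S i x)).
  by apply: measurableT_comp => //; case: (S_mp i).
under eq_integral => x _ do rewrite EFinM -sumEFin.
rewrite ge0_integralZl //; last first.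
- by move=> x _; rewrite sume_ge0 // => i _; rewrite lee_fin.
- by apply: emeasurable_sum => i; exact/measurable_EFinP.
rewrite (@ge0_integral_sum _ _ _ mu [set: X] measurableT _ (fun (i : 'I_m) x => (g (S i x))%:E)).
- under eq_bigr => i _ do
    rewrite integral_measure_preserving // -[(\int[mu]_x (g x)%:E)%E]mul1e.
  rewrite -ge0_sume_distrl // sumEFin sumr_const card_ord muleA -EFinM.
  rewrite -[leRHS]mul1e lee_wpmul2r //.
    by apply: integral_ge0 => x _; rewrite lee_fin.
  rewrite lee_fin; have [->|N_gt0] := posnP N; first by rewrite invr0 mul0r.
  by rewrite mulrC ler_pdivrMr ?mul1r ?ler_nat ?ltr0n.
- by move=> i; exact/measurable_EFinP.
- by move=> i x _; rewrite lee_fin.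
Qed.

(** The transformations are listed with repetitions allowed, as S t 0, S t 1, and
    so on, of which only the first m t enter the average; asking every S t i to be
    measure preserving keeps the summands measurable for all indices. *)
Lemma ae_near_weighted_average_lt (R : realType) (w : nat -> R)
  (d : measure_display) (X : measurableType d) (mu : probability X R)
  (m : nat -> nat) (S : nat -> nat -> X -> X) (f : X -> R) (a : R) :
  (forall t, (1 <= t)%N -> 0 < w t) -> (C1 w < +oo)%E ->
  (forall t, (1 <= t)%N -> (m t <= 2 ^ t)%N) ->
  (forall t i, (1 <= t)%N -> measure_preserving mu (S t i)) ->
  mu.-integrable [set: X] (EFin \o f) -> 0 < a ->
  {ae mu, forall x, \forall t \near \oo,
    w t * 2 ^- t * \sum_(i < m t) `|f (S t i x)| < 2 * a}.
Proof.
move=> w_gt0 C1_fin m_le S_mp f_int a_gt0; have a_ge0 := ltW a_gt0.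
have mf : measurable_fun [set: X] f.
  by apply/measurable_EFinP; exact: measurable_int f_int.
pose g t x := clip w a t.+1 `|f x|.
have mg t : measurable_fun [set: X] (g t).
  apply: (@measurableT_comp _ _ _ _ _ _ (clip w a t.+1)); first exact: measurable_clip.
  exact: measurableT_comp.
have g_ge0 t x : 0 <= g t x by exact: clip_ge0.
have Eg_ge0 t x : (0 <= (g t x)%:E)%E by rewrite lee_fin.
have g_fin : (\sum_(0 <= t <oo) \int[mu]_x (g t x)%:E < +oo)%E.
  rewrite -integral_nneseries //; last by move=> t; exact/measurable_EFinP.
  have C_ge0 : 0 <= 3 * fine (C1 w).
    by rewrite mulr_ge0 // (le_trans (ltW (w_gt0 1%N isT))) // weight_le_C1.
  apply: (@le_lt_trans _ _ (\int[mu]_x ((3 * fine (C1 w))%:E * `|f x|%:E))%E).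
    apply: ge0_le_integral => //.
    - by move=> x _; exact: nneseries_ge0.
    - by apply: ge0_emeasurable_sum => // t _; exact/measurable_EFinP.
    - apply/measurable_EFinP; apply: measurable_funM => //.
      exact: measurableT_comp.
    - move=> x _; apply: lime_le; first exact: is_cvg_nneseries.
      apply: nearW => n; rewrite big_mkord sumEFin -EFinM lee_fin.
      exact: clip_sum_le.
  have /integrableP[_ absf_fin] := f_int.
  rewrite ge0_integralZl_EFin //; first by rewrite lte_mul_pinfty // lee_fin.
  by apply/measurable_EFinP; exact: measurableT_comp.
pose H t x := 2 ^- t.+1 * \sum_(i < m t.+1) g t (S t.+1 i x).
have H_ge0 t x : 0 <= H t x.
  by rewrite mulr_ge0 ?invr_ge0 ?exprn_ge0 // sumr_ge0.
have mH t : measurable_fun [set: X] (H t).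
  apply: measurable_funM => //; apply: measurable_sum => i.
  by apply: measurableT_comp => //; case: (S_mp t.+1 i isT).
have H_fin : (\sum_(0 <= t <oo) \int[mu]_x (H t x)%:E < +oo)%E.
  apply: le_lt_trans g_fin; apply: lee_nneseries => [t _ _|t _].
    by apply: integral_ge0 => x _; rewrite lee_fin.
  rewrite /H -natrX; apply: integral_average_le => //; first exact: m_le.
  by move=> i; exact: S_mp.
have near_lt : {ae mu, forall x, \forall t \near \oo, H t x < a}.
  exact: ae_near_lt_of_integrable_series mH H_ge0 H_fin a_gt0.
apply: filterS near_lt.
move=> x [N _ HN]; exists N.+1 => // -[//|t] /= N_le.
by apply: average_lt_of_clip_average_lt a_gt0 _ (HN t N_le); exact: m_le.
Qed.

Theorem theorem2p2 (R : realType) (w : nat -> R)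
  (w_gt0 : forall t, (1 <= t)%N -> 0 < w t)
  (C1_fin : (C1 w < +oo)%E)
  (d : measure_display) (X : measurableType d) (mu : probability X R)
  (T : nat -> set (X -> X))
  (T_mp : forall t, (1 <= t)%N ->
    forall S, T t S -> measure_preserving mu S)
  (T_card : forall t, (1 <= t)%N -> (T t #<= `I_(2 ^ t))%card)
  (f : X -> R) (f_L1 : f \in Lfun mu 1%E) :
  {ae mu, forall x,
    (fun t : nat => w t * 2 ^- t * \sum_(S \in T t) f (S x)) @ \oo --> (0 : R)}.
Proof.
have f_int : mu.-integrable [set: X] (EFin \o f) by exact/Lfun1_integrable.
(* Listing each set by [nth] with the identity as default makes every entry
   measure preserving, also beyond the end of the list. *)
pose s t : seq (X -> X) := finmap.enum_fset (fset_set (T t)).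
have T_fin t : (1 <= t)%N -> finite_set (T t).
  by move=> t_ge1; apply/finite_set_leP; exists (2 ^ t)%N; exact: T_card.
have s_mp t i : (1 <= t)%N -> measure_preserving mu (nth idfun (s t) i).
  move=> t_ge1; have [i_lt|i_ge] := ltnP i (size (s t)); last first.
    by rewrite nth_default //; split=> //; exact: measurable_id.
  apply: (T_mp t t_ge1); have := mem_nth (idfun : X -> X) i_lt.
  by rewrite in_fset_set ?inE //; exact: T_fin.
have s_size t : (1 <= t)%N -> (size (s t) <= 2 ^ t)%N.
  by move=> t_ge1; exact/geq_card_fset_set/T_card.
have ae_near_lt : {ae mu, forall x, forall n, \forall t \near \oo, w t * 2 ^- t *
    \sum_(i < size (s t)) `|f (nth idfun (s t) i x)| < 2 * n.+1%:R^-1}.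
  apply: ae_foralln => n; apply: (ae_near_weighted_average_lt _ w _ X mu
    (fun t => size (s t)) (fun t => nth idfun (s t)) f) => //.
apply: filterS ae_near_lt.
move=> x near_lt; apply/cvgr0Pnorm_lt => e e_gt0.
have [n] : exists n : nat, 0 + n.+1%:R^-1 < e / 2.
  by apply/ltr_add_invr; rewrite divr_gt0.
rewrite add0r ltr_pdivlMr // mulrC => n_lt.
have [N _ HN] := near_lt n; exists N.+1 => // t /= N_lt.
have t_ge1 : (1 <= t)%N by exact: leq_trans N_lt.
apply: le_lt_trans (lt_trans (HN t (ltnW N_lt)) n_lt).
have wt_ge0 : 0 <= w t * 2 ^- t.
  by rewrite mulr_ge0 ?invr_ge0 ?exprn_ge0 // ltW ?w_gt0.
rewrite fsbig_finite; last exact: T_fin.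
rewrite (big_nth (idfun : X -> X)) big_mkord.
by rewrite normrM ger0_norm // ler_wpM2l // ler_norm_sum.
Qed.
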